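(* For a given linear consensus network $\mathcal N(L_{\mathcal G})\in\mathfrak N(x_0)$, define the input-output $\mathcal H_p$-norm of the network, for every $1\le p\le\infty$, by $$\|G(s)\|_{\mathcal H_p}=\left(\frac1{2\pi}\int_{-\infty}^{\infty}\|G(j\omega)\|_{p^\ast}^p\,d\omega\right)^{1/p},$$ where $G(s)$ is the transfer function of the network from $\xi(t)$ to $y(t)$ and $\|\cdot\|_{p^\ast}$ is the Schatten $p$-norm (for $p=\infty$ this is the $\mathcal H_\infty$-norm $\sup_{\omega\in\mathbb R}\|G(j\omega)\|_{\infty^\ast}$). Then $$\rho\big(\mathcal N(L_{\mathcal G})\big)=\|G(s)\|_{\mathcal H_p}$$ is a Schur-convex systemic measure for all $1\le p\le\infty$.
   Context: All graphs are finite, simple, undirected, connected, on $n$ nodes ($n$ fixed), with positive edge weights: $\mathcal G=(V(\mathcal G),E(\mathcal G),w)$, $w:E(\mathcal G)\to(0,\infty)$. The Laplacian is $L_{\mathcal G}=\Delta-A$, where $A=[a_{ij}]$ has $a_{ij}=w(e)$ if $e=\{i,j\}\in E(\mathcal G)$ and $a_{ij}=0$ otherwise, and $\Delta=\mathrm{diag}(d_1,\dots,d_n)$ with $d_i=\sum_{e=\{i,j\}\in E(\mathcal G)}w(e)$. $L^\dagger$ denotes the Moore–Penrose pseudo-inverse, and $\preceq$ is the positive semidefinite order. Let $M_n=I_n-\frac1n\mathbf 1_n\mathbf 1_n^T$, where $\mathbf 1_n$ is the all-ones vector. The linear consensus network $\mathcal N(L_{\mathcal G})$ is the system $\dot x(t)=-L_{\mathcal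 G}x(t)+\xi(t)$, $y(t)=M_nx(t)$, with exogenous disturbance input $\xi$, output $y$ and fixed initial condition $x_0$; $\mathfrak N(x_0)$ is the set of all such networks. Its transfer function from $\xi$ to $y$ is $G(s)=M_n(sI_n+L_{\mathcal G})^{-1}$, regarded as a rational matrix function (the singularity at $s=0$ is removable). The Schatten $p$-norm is $\|A\|_{p^\ast}=\left(\sum_{i=1}^n\sigma_i^p\right)^{1/p}$, where $\sigma_i$ are the singular values of $A$; for $p=\infty$ it is the spectral norm. A Schur-convex systemic measure is an operator $\rho:\mathfrak N(x_0)\to\mathbb R$ such that for all $\mathcal N(L_{\mathcal G_1}),\mathcal N(L_{\mathcal G_2}),\mathcal N(L_{\mathcal G})\in\mathfrak N(x_0)$: (monotonicity) if $L_{\mathcal G_1}^\dagger\preceq L_{\mathcal G_2}^\dagger$ then $\rho(\mathcal N(L_{\mathcal G_1}))\le\rho(\mathcal N(L_{\mathcal G_2}))$; (convexity) $\rho(\mathcal N(\alpha L_{\mathcal G_1}+(1-\alpha)L_{\mathcal G_2}))\le\alpha\rho(\mathcal N(L_{\mathcal G_1}))+(1-\alpha)\rho(\mathcal N(L_{\mathcal G_2}))$ for all $0\le\alpha\le1$; (orthogonal invariance) $\rho(\mathcal N(L_{\mathcal G}))=\rho(\mathcal N(UL_{\mathcal G}U^T))$ for all orthogonal matrices $U$ ($UU^T=U^TU=I_n$) for which $\mathcal N(UL_{\mathcal G}U^T)$ belongs to the domain $\mathfrak N(x_0)$ of $\rho$.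
   Formalization: For p = 1 and n ≥ 2 the integral diverges and the norm is +∞, so ρ is not real-valued; the measure is therefore taken with values in the extended reals, the three axioms are proved there for all 1 ≤ p ≤ ∞, and real-valuedness is proved for 1 < p ≤ ∞. *)

(* Defs.v *)
From mathcomp Require Import all_boot all_order all_algebra.
From mathcomp Require Import complex.
From mathcomp Require Import all_classical all_reals all_analysis.

Set Implicit Arguments.
Unset Strict Implicit.
Unset Printing Implicit Defensive.

Import Order.TTheory GRing.Theory Num.Theory.
Local Open Scope ring_scope.
Local Open Scope sesquilinear_scope.

(* Values of [weight] on non-adjacent pairs are irrelevant: [adjacency] masks
   them. *)
Record wgraph (R : realType) (n : nat) := WGraph {
  edge : 'I_n -> 'I_n -> bool;
  weight : 'I_n -> 'I_n -> R;
  edge_sym : symmetric edge;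
  edge_irr : irreflexive edge;
  edge_connected : forall i j : 'I_n, connect edge i j;
  weight_sym : forall i j : 'I_n, weight i j = weight j i;
  weight_gt0 : forall i j : 'I_n, edge i j -> 0 < weight i j
}.

Section Laplacian.
Variables (R : realType) (n : nat).

Definition adjacency (G : wgraph R n) : 'M[R]_n :=
  \matrix_(i, j) (if edge G i j then weight G i j else 0).

Definition degrees (G : wgraph R n) : 'rV[R]_n :=
  \row_i \sum_(j | edge G i j) weight G i j.

Definition laplacian (G : wgraph R n) : 'M[R]_n :=
  diag_mx (degrees G) - adjacency G.

End Laplacian.

Section Matrices.
Variables (R : realType) (n : nat).
Implicit Types A B X : 'M[R]_n.

Definition moore_penrose A X : Prop :=
  [/\ A *m X *m A = A, X *m A *m X = X,
      (A *m X)^T = A *m X & (X *m A)^T = X *m A].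

(* Existence and uniqueness: [mp_pinvP] and [moore_penrose_uniq]. *)
Definition mp_pinv A : 'M[R]_n := xget 0 [set X | moore_penrose A X]%classic.

Definition psd A : Prop :=
  A^T = A /\ forall v : 'cV[R]_n, 0 <= (v^T *m A *m v) ord0 ord0.

Definition loewner_le A B : Prop := psd (B - A).

Definition orthogonal_mx (U : 'M[R]_n) : Prop :=
  U *m U^T = 1%:M /\ U^T *m U = 1%:M.

End Matrices.

Section PseudoInverse.
Variable R : realType.

Lemma gram_unitmx m r (C : 'M[R]_(m, r)) :
  row_free C^T -> C^T *m C \in unitmx.
Proof.
move=> fC; rewrite -row_free_unit -kermx_eq0; apply/eqP/row_matrixP => i.
rewrite row0; set v := row i _.
have vC : v *m (C^T *m C) = 0 by apply/sub_kermxP; exact: row_sub.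
have /matrixP/(_ ord0 ord0) : (v *m C^T) *m (v *m C^T)^T = 0.
  by rewrite trmx_mul trmxK mulmxA -(mulmxA v) vC mul0mx.
rewrite !mxE => s0.
have vC0 : v *m C^T = 0.
  apply/rowP => j; rewrite [RHS]mxE.
  have := s0; under eq_bigr => k _ do rewrite [X in _ * X]mxE -expr2.
  move/eqP; rewrite psumr_eq0 => [/allP/(_ j)|k _]; last exact: sqr_ge0.
  by rewrite mem_index_enum /= sqrf_eq0 => /(_ isT)/eqP.
by apply: (row_free_inj fC); rewrite vC0 mul0mx.
Qed.

Lemma moore_penrose_full_rank n r (C : 'M[R]_(n, r)) (D : 'M[R]_(r, n)) :
  C^T *m C \in unitmx -> D *m D^T \in unitmx ->
  moore_penrose (C *m D)
    (D^T *m invmx (D *m D^T) *m (invmx (C^T *m C) *m C^T)).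
Proof.
move=> uC uD.
set P : 'M[R]_r := invmx (C^T *m C); set Q : 'M[R]_r := invmx (D *m D^T).
have PT : P^T = P by rewrite trmx_inv trmx_mul trmxK.
have QT : Q^T = Q by rewrite trmx_inv trmx_mul trmxK.
set X : 'M[R]_n := D^T *m Q *m (P *m C^T).
have PK : P *m (C^T *m C) = 1%:M by exact: mulVmx.
have QK : D *m D^T *m Q = 1%:M by exact: mulmxV.
have AX : C *m D *m X = C *m P *m C^T.
  by rewrite /X -!mulmxA (mulmxA D) (mulmxA _ Q) QK mul1mx.
have XA : X *m (C *m D) = D^T *m Q *m D.
  by rewrite /X -!mulmxA (mulmxA C^T) (mulmxA P) PK mul1mx.
split.
- by rewrite AX -!mulmxA (mulmxA C^T) (mulmxA P) PK mul1mx.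
- by rewrite XA /X -!mulmxA (mulmxA D D^T) (mulmxA (D *m D^T)) QK mul1mx.
- by rewrite AX !trmx_mul trmxK PT mulmxA.
- by rewrite XA !trmx_mul trmxK QT mulmxA.
Qed.

Lemma moore_penrose_uniq n (A X Y : 'M[R]_n) :
  moore_penrose A X -> moore_penrose A Y -> X = Y.
Proof.
move=> [X1 X2 X3 X4] [Y1 Y2 Y3 Y4].
have AXY : A *m X = A *m Y.
  rewrite -X3 -{1}Y1 -mulmxA trmx_mul X3 Y3 mulmxA.
  by rewrite X1.
have XAY : X *m A = Y *m A.
  rewrite -X4 -{1}Y1 !mulmxA -(mulmxA (X *m A)) trmx_mul X4 Y4.
  by rewrite -!mulmxA (mulmxA A) X1.
by rewrite -X2 -mulmxA AXY mulmxA XAY Y2.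
Qed.

Lemma mp_pinvP n (A : 'M[R]_n) : moore_penrose A (mp_pinv A).
Proof.
rewrite /mp_pinv; case: xgetP => [X _ //|noX]; exfalso.
have uC : (col_base A)^T *m col_base A \in unitmx.
  apply: gram_unitmx; rewrite /row_free mxrank_tr.
  exact: col_base_full.
have uD : row_base A *m (row_base A)^T \in unitmx.
  have := @gram_unitmx _ _ (row_base A)^T.
  by rewrite trmxK; apply; exact: row_base_free.
by have := moore_penrose_full_rank uC uD; rewrite mulmx_base; exact: noX.
Qed.

End PseudoInverse.

(* x' = A x + B xi,  y = C x,  x(0) = x0 *)
Record lti_system (R : realType) (n : nat) := LTI {
  sys_A : 'M[R]_n;
  sys_B : 'M[R]_n;
  sys_C : 'M[R]_n;
  sys_x0 : 'cV[R]_n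
}.

Section Networks.
Variables (R : realType) (n : nat).

Definition centering_mx : 'M[R]_n :=
  1%:M - n%:R^-1 *: (const_mx 1 *m (const_mx 1 : 'cV[R]_n)^T).

Definition network (x0 : 'cV[R]_n) (L : 'M[R]_n) : lti_system R n :=
  LTI (- L) 1%:M centering_mx x0.

Definition networks (x0 : 'cV[R]_n) : set (lti_system R n) :=
  [set network x0 (laplacian G) | G in [set: wgraph R n]]%classic.

(* Values are taken in \bar R because the H_1 norm is +oo as soon as n >= 2;
   finiteness is expressed separately by [real_valued].  In the convexity clause the combination is again in the domain, see
   [networks_convex]. *)
Definition schur_convex_systemic_measure (x0 : 'cV[R]_n)
    (rho : lti_system R n -> \bar R) : Prop :=
  [/\ (forall L1 L2 : 'M[R]_n,
         networks x0 (network x0 L1) -> networks x0 (network x0 L2) ->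
         loewner_le (mp_pinv L1) (mp_pinv L2) ->
         (rho (network x0 L1) <= rho (network x0 L2))%E),
      (forall L1 L2 : 'M[R]_n,
         networks x0 (network x0 L1) -> networks x0 (network x0 L2) ->
         forall a : R, 0 <= a <= 1 ->
         (rho (network x0 (a *: L1 + (1 - a) *: L2)) <=
          a%:E * rho (network x0 L1) + (1 - a)%:E * rho (network x0 L2))%E) &
      (forall L U : 'M[R]_n,
         networks x0 (network x0 L) -> orthogonal_mx U ->
         networks x0 (network x0 (U *m L *m U^T)) ->
         rho (network x0 L) = rho (network x0 (U *m L *m U^T)))].

Definition real_valued (x0 : 'cV[R]_n) (rho : lti_system R n -> \bar R) : Prop :=
  forall S, networks x0 S -> rho S \is a fin_num.

Lemma networks_convex (x0 : 'cV[R]_n) (L1 L2 : 'M[R]_n) (a : R) :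
  networks x0 (network x0 L1) -> networks x0 (network x0 L2) -> 0 <= a <= 1 ->
  networks x0 (network x0 (a *: L1 + (1 - a) *: L2)).
Proof.
have inj L L' : network x0 L = network x0 L' -> L = L'.
  by move=> [] /oppr_inj.
move=> [G1 _ /inj <-] [G2 _ /inj <-] /andP[].
rewrite le_eqVlt => /predU1P[<- _|a0].
  by rewrite scale0r add0r subr0 scale1r; exists G2.
rewrite le_eqVlt => /predU1P[->|a1].
  by rewrite subrr scale0r addr0 scale1r; exists G1.
pose w i j := a * adjacency G1 i j + (1 - a) * adjacency G2 i j.
have adj_ge0 G i j : 0 <= adjacency G i j :> R.
  by rewrite mxE; case: ifP => // /weight_gt0/ltW.
have adj_gt0 G i j : edge G i j -> 0 < adjacency G i j :> R.
  by rewrite mxE => /[dup] e ->; exact: weight_gt0.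
have adj_sym (G : wgraph R n) i j : adjacency G i j = adjacency G j i.
  by rewrite !mxE edge_sym weight_sym.
have b0 : 0 < 1 - a by rewrite subr_gt0.
have wp i j : edge G1 i j || edge G2 i j -> 0 < w i j.
  case/orP => e; [apply: ltr_pwDl|apply: ltr_wpDl];
    by rewrite ?mulr_gt0 ?adj_gt0 ?mulr_ge0 ?adj_ge0 ?ltW.
have es : symmetric (fun i j => edge G1 i j || edge G2 i j).
  by move=> i j; rewrite edge_sym (edge_sym G2).
have ei : irreflexive (fun i j => edge G1 i j || edge G2 i j).
  by move=> i; rewrite !edge_irr.
have ec i j : connect (fun i j => edge G1 i j || edge G2 i j) i j.
  apply: (connect_sub _ (edge_connected G1 i j)) => x y e.
  by apply: connect1; rewrite e.
have ws i j : w i j = w j i by rewrite /w adj_sym (adj_sym G2).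
pose G := WGraph es ei ec ws wp.
have adjE : adjacency G = a *: adjacency G1 + (1 - a) *: adjacency G2.
  apply/matrixP => i j; rewrite 3!mxE /=; case: ifPn => [_|].
    by rewrite /w !mxE.
  by rewrite negb_or !mxE => /andP[/negbTE-> /negbTE->]; rewrite !mulr0 addr0.
have degE (H : wgraph R n) : degrees H = \row_i \sum_j adjacency H i j.
  apply/rowP => i; rewrite !mxE big_mkcond.
  by apply: eq_bigr => j _; rewrite mxE.
have degGE : degrees G = a *: degrees G1 + (1 - a) *: degrees G2.
  apply/rowP => i; rewrite !degE !mxE adjE !mulr_sumr -big_split.
  by apply: eq_bigr => j _; rewrite !mxE.
exists G => //; congr network; rewrite /laplacian adjE degGE raddfD /= !linearZ /=.
by rewrite !scalerBr opprD addrACA.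
Qed.

End Networks.

Section TransferFunction.
Variable R : realType.
Local Notation C := R[i].

Definition cst_ratmx n (A : 'M[R]_n) : 'M[{fraction {poly C}}]_n :=
  map_mx (fun a : R => FracField.tofrac (a%:C%C%:P : {poly C})) A.

(* The rational matrix function C (s I - A)^-1 B in the indeterminate s. *)
Definition transfer_function n (S : lti_system R n) :
    'M[{fraction {poly C}}]_n :=
  cst_ratmx (sys_C S) *m
  invmx ((FracField.tofrac ('X : {poly C}))%:M - cst_ratmx (sys_A S)) *m
  cst_ratmx (sys_B S).

(* The fraction is reduced to lowest terms before evaluation, so that removable
   singularities are indeed removed. *)
Definition ratfun_eval (f : {fraction {poly C}}) (s : C) : C :=
  let p := (fraction.frac (repr f)).1 in
  let q := (fraction.frac (repr f)).2 in
  (p %/ gcdp p q).[s] / (q %/ gcdp p q).[s].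

Definition ratmx_eval n (G : 'M[{fraction {poly C}}]_n) (s : C) : 'M[C]_n :=
  map_mx (ratfun_eval^~ s) G.

(* [spectral_diag] lists the (here nonnegative real) eigenvalues of the
   Hermitian matrix A^* A with multiplicity. *)
Definition singular_value n (A : 'M[C]_n) (i : 'I_n) : R :=
  Num.sqrt (complex.Re (spectral_diag (A ^t* *m A) ord0 i)).

Definition schatten_norm (p : \bar R) n (A : 'M[C]_n) : R :=
  match p with
  | p%:E => (\sum_(i < n) singular_value A i `^ p) `^ p^-1
  | _ => \big[Num.max/0]_(i < n) singular_value A i
  end.

(* Only used for 1 <= p, hence the value at p = -oo is irrelevant. *)
Definition Hp_norm (p : \bar R) n (G : 'M[{fraction {poly C}}]_n) : \bar R :=
  let Gj w := ratmx_eval G (0 +i* w)%C in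
  match p with
  | p%:E =>
      (((2 * pi)^-1)%:E *
       \int[@lebesgue_measure R]_w ((schatten_norm p%:E (Gj w)) `^ p)%:E)
      `^ p^-1
  | _ => ereal_sup [set (schatten_norm p (Gj w))%:E | w in [set: R]]
  end%E.

Definition network_Hp_norm (p : \bar R) n (S : lti_system R n) : \bar R :=
  Hp_norm p (transfer_function S).

End TransferFunction.

(* Main.v *)
(* In an orthonormal eigenbasis of the Laplacian L the transfer function is
   diagonal with entries 1 / (s + l_k), where l_k ranges over the nonzero
   eigenvalues; on the kernel of L it is cancelled by the centering matrix.
   Hence the singular values at s = jw are (w^2 + l_k^2)^(-1/2), and rescaling
   w gives

     ||G||_p^p = K_p / (2 pi) * \sum_k l_k^(1 - p)

   with K_p the integral of (1 + t^2)^(-p/2), which is finite exactly for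
   p > 1, and ||G||_oo = max_k 1 / l_k.  The norm is thus a spectral function
   of L, whence orthogonal invariance.  For p = 1 the sum is n - 1, so that the
   norm does not depend on the network; let p > 1 from now on.

   Let L_S >= c L_A + (1 - c) L_B in the Loewner order.  In an eigenbasis of
   L_S the eigenvalues dominate the corresponding combinations of the diagonal
   entries of L_A and L_B.  These diagonal entries are doubly stochastic
   averages of the eigenvalues, so by Jensen's inequality passing to them
   decreases \sum t^(-q), q = p - 1.  It remains to use that
   (\sum_i t_i^(-q))^(1/(q+1)) is a convex function of t > 0, being a decreasing
   convex function of the (concave) power mean of exponent -q.  Convexity is
   the case of equality; monotonicity is the case c = 0, because the
   pseudo-inverse reverses the Loewner order on Laplacians. *)
Require Import Defs.
From mathcomp Require Import all_boot all_order all_algebra.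
From mathcomp Require Import complex.
From mathcomp Require Import all_classical all_reals all_analysis.
From mathcomp Require Import measurable_realfun.
From mathcomp Require Import ring lra.

Set Implicit Arguments.
Unset Strict Implicit.
Unset Printing Implicit Defensive.

Import Order.TTheory GRing.Theory Num.Theory.
Import numFieldNormedType.Exports.
Local Open Scope ring_scope.
Local Open Scope sesquilinear_scope.

(** * The integral of (w^2 + r^2)^(-p/2) *)

Section LorentzianIntegral.
Variable R : realType.
Local Notation mu := (@lebesgue_measure R).
Implicit Types p r x : R.

Definition lorentz r x : R := (Num.sqrt (x ^+ 2 + r ^+ 2))^-1.

Definition lorentz_integral p : \bar R := (\int[mu]_x (lorentz 1 x `^ p)%:E)%E.

Lemma lorentz_ge0 r x : 0 <= lorentz r x.
Proof. by rewrite invr_ge0 sqrtr_ge0. Qed.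

Lemma sqr_lorentz_gt0 r x : 0 < r -> 0 < x ^+ 2 + r ^+ 2.
Proof. by move=> r0; rewrite ltr_wpDl ?sqr_ge0 ?exprn_gt0. Qed.

Lemma lorentz_gt0 r x : 0 < r -> 0 < lorentz r x.
Proof. by move=> r0; rewrite invr_gt0 sqrtr_gt0 sqr_lorentz_gt0. Qed.

Lemma continuous_lorentz_powR r p :
  0 < r -> continuous (fun x => lorentz r x `^ p).
Proof.
move=> r0 x.
apply: (@continuous_comp _ _ _ (lorentz r) (fun y => y `^ p)).
  apply: continuousV.
    by rewrite gt_eqF // sqrtr_gt0 sqr_lorentz_gt0.
  apply: (@continuous_comp _ _ _ (fun x => x ^+ 2 + r ^+ 2) Num.sqrt).
    by apply: continuousD; [exact: exprn_continuous|exact: cst_continuous].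
  exact: sqrt_continuous.
apply/differentiable_continuous/derivable1_diffP/derivable_powR.
by rewrite in_itv /= andbT lorentz_gt0.
Qed.

Lemma measurable_lorentz_powR r p : 0 < r ->
  measurable_fun [set: R] (fun x => (lorentz r x `^ p)%:E).
Proof.
move=> r0; apply/measurable_EFinP; apply: continuous_measurable_fun.
exact: continuous_lorentz_powR.
Qed.

Lemma lorentz_scale r x : 0 < r -> lorentz r (r * x) = r^-1 * lorentz 1 x.
Proof.
move=> r0; rewrite /lorentz.
have -> : (r * x) ^+ 2 + r ^+ 2 = r ^+ 2 * (x ^+ 2 + 1 ^+ 2) by ring.
by rewrite sqrtrM ?sqr_ge0 // sqrtr_sqr gtr0_norm // invfM.
Qed.

(** Substituting [r * x] for [x] extracts [r^(-p)] from the integrand and [r] from the differential.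
    The identity lives in [\bar R], so it also covers exponents for which the integral diverges. *)
Lemma lorentz_integral_scale r p : 0 < r ->
  (\int[mu]_x (lorentz r x `^ p)%:E = (r `^ (1 - p))%:E * lorentz_integral p)%E.
Proof.
move=> r0.
have dF x : is_derive x 1 ( *%R r) r.
  by apply: is_derive_eq; rewrite /GRing.scale /= mulr1.
have F' : derive1 ( *%R r) = cst r.
  by apply/funext => x; rewrite derive1E derive_val.
rewrite (@increasing_ge0_integration_by_substitutionT _ ( *%R r)).
- rewrite /lorentz_integral -ge0_integralZl //=; last 3 first.
  + exact: measurable_lorentz_powR.
 + by move=> x _; exact: (powR_ge0 (lorentz 1 x) p).
  + exact: (powR_ge0 r (1 - p)).
  apply: eq_integral => x _ /=; rewrite -EFinM; congr (_%:E).
  transitivity (lorentz r (r * x) `^ p * r); first by rewrite F'.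
  rewrite lorentz_scale // powRM ?invr_ge0 ?(ltW r0) ?lorentz_ge0 //.
  rewrite mulrC mulrA; congr (_ * _).
  rewrite -powR_inv1 ?(ltW r0) // -powRrM mulN1r -{1}[r]powRr1 ?(ltW r0) //.
  by rewrite -powRD // (gt_eqF r0) implybT.
- by move=> x y xy; rewrite ltr_pM2l.
- by rewrite F'; exact: cst_continuous.
- by rewrite F'; exact: is_cvg_cst.
- by rewrite F'; exact: is_cvg_cst.
- by move=> x; exact: (@ex_derive _ _ _ _ _ _ _ (dF x)).
- exact: gt0_cvgMrNy r0 cvg_id.
- exact: gt0_cvgMry r0 cvg_id.
- exact: continuous_lorentz_powR.
- by move=> x; rewrite powR_ge0.
Qed.

Lemma lorentz_integral_ge0 p : (0 <= lorentz_integral p)%E.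
Proof. by apply: integral_ge0 => x _; rewrite lee_fin powR_ge0. Qed.

Lemma cvg_powR_pinfty r : 0 < r ->
  ((1 + x) `^ r @[x --> +oo%R] --> +oo%R)%classic.
Proof.
move=> r0; apply/cvgryPge => A; near=> x.
have x1 : `|A| `^ r^-1 <= 1 + x.
  by rewrite ler_wpDl //; near: x; exact: nbhs_pinfty_ge.
apply: (le_trans (ler_norm A)).
have -> : `|A| = (`|A| `^ r^-1) `^ r.
  by rewrite -powRrM mulVf ?lt0r_neq0 // powRr1.
have x1_ge0 : 0 <= 1 + x by exact: le_trans (powR_ge0 _ _) x1.
by apply: ge0_ler_powR; rewrite ?nnegrE ?powR_ge0 ?(ltW r0).
Unshelve. all: by end_near. Qed.

Lemma integral_powR_shift p : 1 < p ->
  (\int[mu]_(x in `[0%R, +oo[) ((1 + x) `^ (- p))%:E = ((p - 1)^-1)%:E)%E.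
Proof.
move=> p1.
pose F x := (1 - p)^-1 * (1 + x) `^ (1 - p).
have p10 : 1 - p != 0 by rewrite subr_eq0 lt_eqF.
have dF x : 0 <= x -> is_derive x 1 F ((1 + x) `^ (- p)).
  move=> x0; have x10 : 0 < 1 + x by rewrite ltr_pwDl.
  have d1 : is_derive x 1 (fun x => 1 + x) 1.
    by apply: is_derive_eq; rewrite add0r mulr1.
  have d2 := is_derive1_powR (1 - p) x10.
  have d := is_deriveZ (1 - p)^-1 (is_derive1_comp d2 d1).
  apply: is_derive_eq d _.
  rewrite /GRing.scale /= mulr1 mulrA mulVf // mul1r; congr powR; ring.
have cF x : 0 <= x -> {for x, continuous F}.
  move=> /dF dFx; apply/differentiable_continuous/derivable1_diffP.
  exact: ex_derive.
have -> : ((p - 1)^-1)%:E = (0%:E - (F 0)%:E)%E.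
  by rewrite /F addr0 powR1 mulr1 sub0e -EFinN -invrN opprB.
apply: ge0_continuous_FTC2y.
- by move=> x _; exact: powR_ge0.
- apply: continuous_in_subspaceT => x; rewrite inE /= in_itv /= andbT => x0.
  have x10 : 0 < 1 + x by rewrite ltr_pwDl.
  apply: (@continuous_comp _ _ _ (fun x => 1 + x) (fun y => y `^ (- p))).
    by apply: continuousD; [exact: cst_continuous|exact: cvg_id].
  apply/differentiable_continuous/derivable1_diffP/derivable_powR.
  by rewrite in_itv /= andbT.
- rewrite -[X in (_ --> X)%classic](mulr0 (1 - p)^-1).
  apply: cvgM; first exact: cvg_cst.
  under eq_fun do rewrite -opprB powRN.
  apply/gtr0_cvgV0; last by apply: cvg_powR_pinfty; rewrite subr_gt0.
  apply: filterS (nbhs_pinfty_ge (num_real (0 : R))) => x x0.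
  by rewrite powR_gt0 // ltr_pwDl.
- by move=> x /ltW /dF dFx; exact: ex_derive.
- by apply: cvg_at_right_filter; exact: cF.
- move=> x; rewrite in_itv /= andbT => /ltW /dF dFx.
  by rewrite derive1E derive_val.
Qed.

(** After inverting and squaring this is [(1 + x)^2 / 4 <= x^2 + 1]. *)
Lemma lorentz_le x : 0 <= x -> lorentz 1 x <= 2 * (1 + x)^-1.
Proof.
move=> x0; have x1 : 0 < 1 + x by rewrite ltr_pwDl.
have s0 : 0 < Num.sqrt (x ^+ 2 + 1 ^+ 2) by rewrite sqrtr_gt0 sqr_lorentz_gt0.
rewrite /lorentz -[2]invrK -invfM lef_pV2 ?posrE ?mulr_gt0 ?invr_gt0 //.
rewrite -[X in X <= _]gtr0_norm ?mulr_gt0 ?invr_gt0 // -sqrtr_sqr.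
by rewrite ler_wsqrtr //; nra.
Qed.

(** The integrand is even, and on the half-line it is dominated by [2^p * (1 + x)^(-p)], whose
    integral is known explicitly. *)
Lemma lorentz_integral_fin p : 1 < p -> lorentz_integral p \is a fin_num.
Proof.
move=> p1; rewrite ge0_fin_numE ?lorentz_integral_ge0 //.
have mf : measurable_fun (`[0%R, +oo[%classic : set R)
    (fun x => ((1 + x) `^ (- p))%:E).
  apply/measurable_funTS/measurable_EFinP.
  by apply: (measurableT_comp (measurable_powR _)); exact: measurable_funD.
rewrite /lorentz_integral ge0_symfun_integralT.
- have -> : [set x : R | (0 <= x)%R]%classic = `[0%R, +oo[%classic.
    by rewrite set_itvcy.
  apply: (@le_lt_trans _ _ (2%:E * \int[mu]_(x in `[0%R, +oo[)
      ((2 `^ p)%:E * ((1 + x) `^ (- p))%:E)))%E.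
    apply: lee_wpmul2l => //.
    apply: ge0_le_integral => //.
    + by move=> x _; rewrite lee_fin; exact: powR_ge0.
    + by apply: measurable_funTS; exact: measurable_lorentz_powR.
    + exact: measurable_funeM.
    + move=> x; rewrite /= in_itv /= andbT => x0; rewrite -EFinM lee_fin.
      have x1 : 0 < 1 + x by rewrite ltr_pwDl.
      have -> : (1 + x) `^ (- p) = (1 + x)^-1 `^ p.
        by rewrite -(powR_inv1 (ltW x1)) -powRrM mulN1r.
      rewrite -powRM ?invr_ge0 ?(ltW x1) // ge0_ler_powR ?nnegrE ?lorentz_ge0 //.
      + by lra.
      + by rewrite mulr_ge0 ?invr_ge0 ?(ltW x1).
      + exact: lorentz_le.
  rewrite ge0_integralZl //.
  + by rewrite integral_powR_shift // -!EFinM ltry.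
  + by move=> x _; rewrite lee_fin powR_ge0.
- by move=> x; exact: powR_ge0.
- exact: continuous_lorentz_powR.
- by move=> x; rewrite /= /lorentz sqrrN.
Qed.

End LorentzianIntegral.

(** * Convexity of negative powers *)

Section NegativePowers.
Variable R : realType.
Implicit Types (r x y t c q : R).

(** The tangent line at [y = 1], from [exp t >= 1 + t] with [t = - r * ln y] and [ln y <= y - 1]. *)
Lemma powRN_tangent r y : 0 <= r -> 0 < y -> 1 - r * (y - 1) <= y `^ (- r).
Proof.
move=> r0 y0; rewrite /powR gt_eqF //.
apply: le_trans (expR_ge1Dx _); rewrite lerD2l mulNr lerN2 ler_wpM2l //.
have := @le_ln1Dx R (y - 1); have -> : 1 + (y - 1) = y by ring.
by apply; lra.
Qed.

Lemma powRN_jensen (I : finType) (Q : pred I) (w x : I -> R) r :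
  0 <= r -> (forall i, 0 <= w i) -> \sum_(i | Q i) w i = 1 ->
  (forall i, Q i -> 0 < x i) ->
  0 < \sum_(i | Q i) w i * x i /\
  (\sum_(i | Q i) w i * x i) `^ (- r) <= \sum_(i | Q i) w i * x i `^ (- r).
Proof.
move=> r0 w0 w1 x0; set X := \sum_(i | Q i) w i * x i.
have wx0 i : Q i -> 0 <= w i * x i by move=> Qi; rewrite mulr_ge0 ?w0 ?ltW ?x0.
have X0 : 0 < X.
  rewrite lt_def sumr_ge0 // andbT; apply/eqP => /(psumr_eq0P wx0) wx.
  have := w1; rewrite big1 => [/esym/eqP|i Qi]; first by rewrite oner_eq0.
  by have /eqP := wx i Qi; rewrite mulf_eq0 (gt_eqF (x0 _ Qi)) orbF => /eqP.
split=> //.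
(* The tangent inequality is applied at each [x i / X]. Since these ratios have weighted mean 1, the
   linear terms cancel in the sum. *)
have -> : X `^ (- r) =
          \sum_(i | Q i) w i * (X `^ (- r) * (1 - r * (x i / X - 1))).
  under eq_bigr => i _ do rewrite mulrCA.
  rewrite -mulr_sumr.
  have -> : \sum_(i | Q i) w i * (1 - r * (x i / X - 1)) =
            \sum_(i | Q i) ((1 + r) * w i - r / X * (w i * x i)).
    by apply: eq_bigr => i _; ring.
  rewrite sumrB -!mulr_sumr w1 -/X mulr1 -mulrA mulVf ?gt_eqF //; ring.
apply: ler_sum => i Qi; apply: ler_wpM2l => //.
rewrite -[x i in leRHS](divfK (lt0r_neq0 X0)).
rewrite powRM ?(ltW X0) ?divr_ge0 ?(ltW X0) ?(ltW (x0 _ Qi)) //.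
rewrite [leLHS]mulrC ler_wpM2r ?powR_ge0 //.
by rewrite powRN_tangent // divr_gt0 // x0.
Qed.

Lemma powRN_convex c x y r : 0 <= c <= 1 -> 0 <= r -> 0 < x -> 0 < y ->
  0 < c * x + (1 - c) * y /\
  (c * x + (1 - c) * y) `^ (- r) <= c * x `^ (- r) + (1 - c) * y `^ (- r).
Proof.
move=> /andP[c0 c1] r0 x0 y0.
have := @powRN_jensen bool predT (fun b => if b then c else 1 - c)
  (fun b => if b then x else y) r r0.
rewrite !big_bool /=; apply; [by case; lra|ring|by case].
Qed.

(** Upper bounds [TA], [TB] replace the sums themselves, so that the estimates for diagonal entries
    can be fed in directly. *)
Lemma power_mean_convex (I : finType) (Q : pred I) (a b : I -> R) c q TA TB :
  0 <= c <= 1 -> 0 < q ->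
  (forall i, Q i -> 0 < a i) -> (forall i, Q i -> 0 < b i) ->
  0 < TA -> 0 < TB ->
  \sum_(i | Q i) a i `^ (- q) <= TA -> \sum_(i | Q i) b i `^ (- q) <= TB ->
  (\sum_(i | Q i) (c * a i + (1 - c) * b i) `^ (- q)) `^ (1 + q)^-1 <=
  c * TA `^ (1 + q)^-1 + (1 - c) * TB `^ (1 + q)^-1.
Proof.
move=> c01 q0 a0 b0 TA0 TB0 sA sB.
have /andP[c0 c1] := c01.
(* Up to normalization, [u] and [v] are power means of exponent [-q]; the sums for [a / u] and
   [b / v] are then at most 1. *)
pose u := TA `^ (- q^-1); pose v := TB `^ (- q^-1).
have u0 : 0 < u by exact: powR_gt0.
have v0 : 0 < v by exact: powR_gt0.
have uq : u `^ q = TA^-1.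
  by rewrite -powRrM mulNr mulVf ?gt_eqF // powR_inv1 // ltW.
have vq : v `^ q = TB^-1.
  by rewrite -powRrM mulNr mulVf ?gt_eqF // powR_inv1 // ltW.
(* This exponent gives [u^(-r) = TA^(1/(1+q))], so convexity of [t^(-r)] reduces the claim to the
   bound [m^(-q)] on the sum, where [m = c * u + (1 - c) * v]. *)
pose r := q / (1 + q).
have r0 : 0 <= r by rewrite divr_ge0 ?ltW // addr_gt0.
have ur : u `^ (- r) = TA `^ (1 + q)^-1.
  by rewrite -powRrM mulrNN /r mulrA mulVf ?gt_eqF // mul1r.
have vr : v `^ (- r) = TB `^ (1 + q)^-1.
  by rewrite -powRrM mulrNN /r mulrA mulVf ?gt_eqF // mul1r.
have [m0 mr] := powRN_convex c01 r0 u0 v0.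
rewrite ur vr in mr; apply: le_trans mr.
set m := _ + _ in m0 *.
have -> : m `^ (- r) = (m `^ (- q)) `^ (1 + q)^-1.
  by rewrite -powRrM mulNr.
apply: ge0_ler_powR; rewrite ?nnegrE ?powR_ge0 ?invr_ge0 ?addr_ge0 ?(ltW q0) //.
  by apply: sumr_ge0 => i _; exact: powR_ge0.
(* With this weight [(c * a i + (1 - c) * b i) / m] is the convex combination of [a i / u] and
   [b i / v]. *)
pose d := c * u / m.
have d01 : 0 <= d <= 1.
  rewrite divr_ge0 ?mulr_ge0 ?(ltW u0) ?(ltW m0) //= ler_pdivrMr // mul1r.
  by rewrite lerDl mulr_ge0 ?(ltW v0) // subr_ge0.
have d1 : 1 - d = (1 - c) * v / m.
  apply: (mulIf (lt0r_neq0 m0)); rewrite mulrBl /d !divfK ?gt_eqF // /m; ring.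
have term i : Q i -> (c * a i + (1 - c) * b i) `^ (- q) <=
    m `^ (- q) * (d * (a i `^ (- q) / TA) + (1 - d) * (b i `^ (- q) / TB)).
  move=> Qi.
  have au0 : 0 < a i / u by rewrite divr_gt0 // a0.
  have bv0 : 0 < b i / v by rewrite divr_gt0 // b0.
  have [e0 eq] := powRN_convex d01 (ltW q0) au0 bv0.
  have -> : c * a i + (1 - c) * b i = m * (d * (a i / u) + (1 - d) * (b i / v)).
    rewrite d1 /d; field; by rewrite !gt_eqF.
  rewrite powRM ?(ltW m0) ?(ltW e0) // ler_wpM2l ?powR_ge0 //.
  apply: le_trans eq _.
  rewrite !powRM ?invr_ge0 ?(ltW u0) ?(ltW v0) ?(ltW (a0 _ Qi))
    ?(ltW (b0 _ Qi)) //.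
  have inv_pow z : 0 < z -> z^-1 `^ (- q) = z `^ q.
    by move=> z0; rewrite -powR_inv1 ?(ltW z0) // -powRrM mulrNN mul1r.
  by rewrite !inv_pow // uq vq.
apply: (le_trans (ler_sum _ term)).
rewrite -mulr_sumr -[leRHS]mulr1 ler_wpM2l ?powR_ge0 //.
rewrite big_split /= -!mulr_sumr -!mulr_suml.
have hA : (\sum_(i | Q i) a i `^ (- q)) / TA <= 1.
  by rewrite ler_pdivrMr // mul1r.
have hB : (\sum_(i | Q i) b i `^ (- q)) / TB <= 1.
  by rewrite ler_pdivrMr // mul1r.
have /andP[d0 d1'] := d01.
rewrite -[leRHS](subrK d) [leRHS]addrC.
by apply: lerD; rewrite ler_piMr // subr_ge0.
Qed.

End NegativePowers.

(** * Laplacians and their pseudo-inverses *)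

Section LaplacianMatrices.
Variables (R : realType) (n : nat).
Implicit Types (G : wgraph R n) (A B X : 'M[R]_n).
Local Notation M := (centering_mx R n).

Lemma psdD A B : psd A -> psd B -> psd (A + B).
Proof.
move=> [AT A0] [BT B0]; split=> [|v]; first by rewrite raddfD /= AT BT.
by rewrite mulmxDr mulmxDl mxE addr_ge0.
Qed.

Lemma psd_congr A X : psd A -> psd (X^T *m A *m X).
Proof.
move=> [AT A0]; split=> [|v]; first by rewrite !trmx_mul trmxK AT mulmxA.
by have := A0 (X *m v); rewrite trmx_mul !mulmxA.
Qed.

Lemma adjacency_sym G i j : adjacency G i j = adjacency G j i.
Proof. by rewrite !mxE edge_sym weight_sym. Qed.

Lemma degreesE G i : degrees G 0 i = \sum_j adjacency G i j.
Proof.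
by rewrite !mxE big_mkcond; apply: eq_bigr => j _; rewrite mxE.
Qed.

Lemma laplacian_sym G : (laplacian G)^T = laplacian G.
Proof.
rewrite /laplacian raddfB /= tr_diag_mx; congr (_ - _).
by apply/matrixP => i j; rewrite mxE adjacency_sym.
Qed.

Lemma laplacian_mulE G m (X : 'M[R]_(n, m)) i k :
  (laplacian G *m X) i k = \sum_j adjacency G i j * (X i k - X j k).
Proof.
rewrite /laplacian mulmxBl mul_diag_mx mxE [X in X + _]mxE [X in _ + X]mxE.
rewrite degreesE [X in _ - X]mxE mulr_suml -sumrB.
by apply: eq_bigr => j _; rewrite -mulrBr.
Qed.

(** The Dirichlet form: doubling the quadratic form and exchanging [i] and [j] in one copy completes
    the squares. *)
Lemma laplacian_form G (v : 'cV[R]_n) :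
  (v^T *m laplacian G *m v) ord0 ord0 =
  2^-1 * \sum_i \sum_j adjacency G i j * (v i 0 - v j 0) ^+ 2.
Proof.
apply: (@mulfI _ 2) => //; rewrite mulrA divff // mul1r -mulmxA mxE.
under eq_bigr do rewrite laplacian_mulE mulr_sumr mxE.
rewrite mulr_natl mulr2n [X in _ + X]exchange_big -big_split /=.
apply: eq_bigr => i _; rewrite -big_split; apply: eq_bigr => j _ /=.
rewrite (adjacency_sym G j i); ring.
Qed.

Lemma adjacency_ge0 G i j : 0 <= adjacency G i j.
Proof. by rewrite mxE; case: ifP => // /weight_gt0/ltW. Qed.

Lemma psd_laplacian G : psd (laplacian G).
Proof.
split=> [|v]; first exact: laplacian_sym.
rewrite laplacian_form mulr_ge0 ?invr_ge0 //.
by do 2![apply: sumr_ge0 => ? _]; rewrite mulr_ge0 ?adjacency_ge0 ?sqr_ge0.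
Qed.

Lemma laplacian_const G : laplacian G *m (const_mx 1 : 'cV_n) = 0.
Proof.
apply/matrixP => i k; rewrite laplacian_mulE big1 ?mxE // => j _.
by rewrite !mxE subrr mulr0.
Qed.

(** The Dirichlet form vanishes at [v], hence so does each of its nonnegative terms; [v] is constant
    along edges, and connectedness does the rest. *)
Lemma laplacian_ker G (v : 'cV[R]_n) i j :
  laplacian G *m v = 0 -> v i 0 = v j 0.
Proof.
move=> Lv; have := laplacian_form G v.
rewrite -mulmxA Lv mulmx0 mxE => /esym/eqP.
have t0 x y : 0 <= adjacency G x y * (v x 0 - v y 0) ^+ 2.
  by rewrite mulr_ge0 ?adjacency_ge0 ?sqr_ge0.
rewrite mulf_eq0 invr_eq0 pnatr_eq0 /= => /eqP s0.
have edge_eq x y : edge G x y -> v x 0 = v y 0.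
  move=> e; have /eqP : adjacency G x y * (v x 0 - v y 0) ^+ 2 = 0.
    have /psumr_eq0P s1 : \sum_y adjacency G x y * (v x 0 - v y 0) ^+ 2 = 0.
      have /psumr_eq0P -> // := s0.
      by move=> z _; apply: sumr_ge0.
    by rewrite s1.
  rewrite mulf_eq0 mxE e sqrf_eq0 subr_eq0 => /predU1P[w0|/eqP //].
  by have := weight_gt0 e; rewrite w0 ltxx.
have /connectP[s + ->] := edge_connected G i j.
by elim: s i => //= y s IH x /andP[/edge_eq-> /IH].
Qed.

Lemma centering_sym : M^T = M.
Proof.
by rewrite /centering_mx raddfB /= tr_scalar_mx linearZ /= trmx_mul trmxK.
Qed.

Lemma centering_kill m (X : 'M[R]_(n, m)) :
  (forall i j k, X i k = X j k) -> M *m X = 0.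
Proof.
move=> cX; apply/matrixP => i k.
rewrite /centering_mx mulmxBl mul1mx -scalemxAl -mulmxA !mxE.
rewrite big_ord1 !mxE mul1r.
under eq_bigr => j _ do rewrite !mxE mul1r (cX j i k).
rewrite sumr_const card_ord -[X in _ * X]mulr_natl mulrA mulVf ?mul1r ?subrr //.
by rewrite pnatr_eq0 -lt0n (leq_ltn_trans _ (ltn_ord i)).
Qed.

(** The columns of [X] are constant vectors, which centering kills. This inclusion of kernels is
    where connectedness enters the matrix calculus. *)
Lemma laplacian_annihilates G m (X : 'M[R]_(n, m)) :
  laplacian G *m X = 0 -> M *m X = 0.
Proof.
move=> LX; apply: centering_kill => i j k.
have := @laplacian_ker G (col k X) i j; rewrite !mxE; apply.
by rewrite colE mulmxA LX mul0mx.
Qed.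

Lemma mul_laplacian_centering G : laplacian G *m M = laplacian G.
Proof.
by rewrite /centering_mx mulmxBr mulmx1 -scalemxAr mulmxA laplacian_const
           mul0mx scaler0 subr0.
Qed.

Lemma mul_centering_laplacian G : M *m laplacian G = laplacian G.
Proof.
by rewrite -centering_sym -laplacian_sym -trmx_mul mul_laplacian_centering.
Qed.

(** The transpose satisfies the same four Penrose equations, so uniqueness applies. *)
Lemma pinv_laplacian_sym G :
  (mp_pinv (laplacian G))^T = mp_pinv (laplacian G).
Proof.
have [X1 X2 X3 X4] := mp_pinvP (laplacian G).
apply: (@moore_penrose_uniq _ _ (laplacian G)); last exact: mp_pinvP.
have LT := laplacian_sym G.
set X := mp_pinv _ in X1 X2 X3 X4 *; set L := laplacian G in X1 X2 X3 X4 LT *.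
split.
- by rewrite -[RHS]LT -[in RHS]X1 !trmx_mul LT mulmxA.
- by rewrite -[in RHS]X2 !trmx_mul LT mulmxA.
- by rewrite trmx_mul trmxK LT -X4 trmx_mul LT.
- by rewrite trmx_mul trmxK LT -X3 trmx_mul LT.
Qed.

(** The Laplacian annihilates [1 - X *m L], hence so does [M], which gives [M = M *m (X *m L)]. As
    [X *m L] is symmetric and [L *m M = L], the right-hand side is [X *m L]. *)
Lemma mul_pinv_laplacian G :
  mp_pinv (laplacian G) *m laplacian G = M.
Proof.
have [X1 X2 X3 X4] := mp_pinvP (laplacian G).
set L := laplacian G in X1 X2 X3 X4 *; set X := mp_pinv _ in X1 X2 X3 X4 *.
have : M *m (1%:M - X *m L) = 0.
  apply: (@laplacian_annihilates G).
  by rewrite mulmxBr mulmx1 mulmxA X1 subrr.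
rewrite mulmxBr mulmx1 => /eqP; rewrite subr_eq0 => /eqP ->.
by rewrite -[RHS]trmxK trmx_mul X4 centering_sym -mulmxA
  mul_laplacian_centering X4.
Qed.

Lemma mul_laplacian_pinv G :
  laplacian G *m mp_pinv (laplacian G) = M.
Proof.
rewrite -centering_sym -(mul_pinv_laplacian G) trmx_mul.
by rewrite pinv_laplacian_sym laplacian_sym.
Qed.

Lemma psd_pinv_laplacian G : psd (mp_pinv (laplacian G)).
Proof.
have [_ X2 _ _] := mp_pinvP (laplacian G).
rewrite -X2 -{1}pinv_laplacian_sym; exact/psd_congr/psd_laplacian.
Qed.

(** Writes [L1 - L2] as a sum of congruences of [X1] and [X2 - X1]. Both summands are positive
    semidefinite when [X1 <= X2], which yields order reversal without square roots of matrices. *)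
Lemma inverse_difference (L1 L2 X1 X2 P : 'M[R]_n) :
  L1 *m X1 = P -> X1 *m L1 = P -> L2 *m X2 = P ->
  P *m L1 = L1 -> P *m L2 = L2 -> L2 *m P = L2 ->
  L1 - L2 = (L2 - L1) *m X1 *m (L2 - L1) + L2 *m (X2 - X1) *m L2.
Proof.
move=> LX1 XL1 LX2 PL1 PL2 LP2.
rewrite !(mulmxBl, mulmxBr) LX1 LX2 PL2 PL1 -(mulmxA _ _ L1) XL1 LP2.
by apply/matrixP => i j; rewrite !mxE; ring.
Qed.

Lemma loewner_le_pinv G1 G2 :
  loewner_le (mp_pinv (laplacian G1)) (mp_pinv (laplacian G2)) ->
  loewner_le (laplacian G2) (laplacian G1).
Proof.
move=> le12; rewrite /loewner_le.
have dT : (laplacian G2 - laplacian G1)^T = laplacian G2 - laplacian G1.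
  by rewrite raddfB /= !laplacian_sym.
rewrite (inverse_difference (mul_laplacian_pinv G1) (mul_pinv_laplacian G1)
  (mul_laplacian_pinv G2) (mul_centering_laplacian G1)
  (mul_centering_laplacian G2) (mul_laplacian_centering G2)).
apply: psdD; first by rewrite -{1}dT; exact/psd_congr/psd_pinv_laplacian.
by rewrite -{1}laplacian_sym; exact: psd_congr.
Qed.

End LaplacianMatrices.

(** * Unitary diagonalization and Rayleigh quotients *)

Section SpectralDecomposition.
Variables (R : realType) (n : nat).
Local Notation C := R[i].
Local Notation toC := (map_mx (real_complex R)).
Implicit Types (G : wgraph R n) (A B L : 'M[R]_n).
Implicit Types (P Q : 'M[C]_n) (l : 'rV[R]_n).

(** The eigenvectors are the columns of [P^t*]. They may be complex, while the eigenvalues are kept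
    real so that they can be compared. *)
Definition spectral_dec L P l : Prop :=
  P \is unitarymx /\ toC L = P^t* *m diag_mx (toC l) *m P.

Definition rayleigh P A i : R := complex.Re ((P *m toC A *m P^t*) i i).

Definition support_row l : 'rV[R]_n := \row_k (l 0 k != 0)%:R.

Lemma conjC_real (r : R) : (r%:C%C)^* = r%:C%C.
Proof. by apply/CrealP; apply/complex_realP; exists r. Qed.

Lemma conjC_rect (z : C) :
  z^* = (complex.Re z)%:C%C - 'i%C * (complex.Im z)%:C%C.
Proof.
rewrite {1}[z]complexE rmorphD rmorphM complexiE /=.
by rewrite conjCi !conjC_real mulNr.
Qed.

(** Transfers the inclusion of kernels from real to complex matrices. *)
Lemma mul_toC_eq0 m (A : 'M[R]_n) (Z : 'M[C]_(n, m)) :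
  toC A *m Z = 0 <->
  A *m map_mx (@complex.Re R) Z = 0 /\ A *m map_mx (@complex.Im R) Z = 0.
Proof.
set X := map_mx _ Z; set Y := map_mx (@complex.Im R) Z.
have -> : Z = toC X + 'i%C *: toC Y.
  by apply/matrixP => j k; rewrite !mxE; exact: complexE.
rewrite mulmxDr -scalemxAr -!map_mxM; split=> [/matrixP AZ|[-> ->]].
  by split; apply/matrixP => i j; have := AZ i j; rewrite !mxE => /eqP;
    rewrite eq_complex /= => /andP[/eqP + /eqP]; lra.
by rewrite !map_mx0 scaler0 addr0.
Qed.

Lemma map_real_conj m k (A : 'M[R]_(m, k)) :
  (map_mx (real_complex R) A)^t* = map_mx (real_complex R) A^T.
Proof. by apply/matrixP => i j; rewrite !mxE conjC_real. Qed.

Lemma trmxC_mul m k r (A : 'M[C]_(m, k)) (B : 'M[C]_(k, r)) :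
  (A *m B)^t* = B^t* *m A^t*.
Proof. by rewrite trmx_mul map_mxM. Qed.

Lemma unitary_diag_eq P (a b : 'rV[C]_n) : (forall k, a 0 k = b 0 k) ->
  P^t* *m diag_mx a *m P = P^t* *m diag_mx b *m P.
Proof. by move=> ab; have -> : a = b by apply/rowP. Qed.

Lemma unitary_diagM P (a b : 'rV[C]_n) : P \is unitarymx ->
  (P^t* *m diag_mx a *m P) *m (P^t* *m diag_mx b *m P) =
  P^t* *m diag_mx (\row_j (a 0 j * b 0 j)) *m P.
Proof.
move=> uP; rewrite -mulmx_diag !mulmxA -(mulmxA _ P (P^t*)).
by rewrite (unitarymxP uP) mulmx1.
Qed.

Lemma spectral_dec_exists L : L^T = L -> exists P l, spectral_dec L P l.
Proof.
move=> LT.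
have hL : toC L \is hermsymmx.
  by apply/is_hermitianmxP; rewrite expr0 scale1r map_real_conj LT.
exists (spectralmx (toC L)), (\row_i complex.Re (spectral_diag (toC L) 0 i)).
split; first exact: spectral_unitarymx.
have /orthomx_spectralP := hermitian_normalmx hL.
rewrite (invmx_unitary (spectral_unitarymx _)) => {1}->.
apply: unitary_diag_eq => i; rewrite !mxE.
by rewrite RRe_real //; exact: (mxOverP (hermitian_spectral_diag_real hL)).
Qed.

Lemma spectral_decK L P l : spectral_dec L P l ->
  P *m toC L *m P^t* = diag_mx (toC l).
Proof.
move=> [uP ->]; rewrite !mulmxA (unitarymxP uP) mul1mx -mulmxA.
by rewrite (unitarymxP uP) mulmx1.
Qed.

Lemma rayleigh_eigen L P l i : spectral_dec L P l -> rayleigh P L i = l 0 i.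
Proof.
by move=> /spectral_decK; rewrite /rayleigh => ->; rewrite !mxE eqxx.
Qed.

Lemma rayleighD P A B i :
  rayleigh P (A + B) i = rayleigh P A i + rayleigh P B i.
Proof.
rewrite /rayleigh map_mxD mulmxDr mulmxDl mxE.
by case: (_ i i) (_ i i) => [? ?] [].
Qed.

Lemma rayleighZ P a A i : rayleigh P (a *: A) i = a * rayleigh P A i.
Proof.
rewrite /rayleigh map_mxZ -scalemxAr -scalemxAl mxE.
by case: (_ i i) => x y; rewrite /= mul0r subr0.
Qed.

(** The diagonal entry of [W diag(l) W^*] for [W = P *m Q^t*]. When [P] is unitary so is [W], and
    the weights are doubly stochastic. *)
Lemma rayleigh_dec A P Q l i : spectral_dec A Q l ->
  rayleigh P A i =
  \sum_j ComplexField.Normc.normc ((P *m Q^t*) i j) ^+ 2 * l 0 j.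
Proof.
move=> [_ eA]; rewrite /rayleigh eA !mulmxA -[_ *m _ *m Q *m _]mulmxA.
have -> : Q *m P^t* = (P *m Q^t*)^t* by rewrite trmxC_mul trmxCK.
set W := P *m Q^t*.
suff -> : (W *m diag_mx (toC l) *m W^t*) i i =
  (\sum_j ComplexField.Normc.normc (W i j) ^+ 2 * l 0 j)%:C%C by [].
rewrite mul_mx_diag mxE rmorph_sum; apply: eq_bigr => j _ /=.
by rewrite !mxE rmorphM rmorphXn /= mulrAC -normCK.
Qed.

(** With [P = X + iY], the real part of [P A P^*] is [X A X^T + Y A Y^T], which reduces to
    positivity on real vectors. *)
Lemma rayleigh_psd P A i : psd A -> 0 <= rayleigh P A i.
Proof.
move=> [AT A0].
set X := map_mx (@complex.Re R) P; set Y := map_mx (@complex.Im R) P.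
have eP : P = toC X + 'i%C *: toC Y.
  by apply/matrixP => j k; rewrite !mxE; exact: complexE.
have ePt : P^t* = toC X^T - 'i%C *: toC Y^T.
  by apply/matrixP => j k; rewrite !mxE conjC_rect.
have pos (Z : 'M[R]_n) : 0 <= (Z *m A *m Z^T) i i.
  have := A0 (row i Z)^T; rewrite trmxK -row_mul.
  suff -> : (row i (Z *m A) *m (row i Z)^T) ord0 ord0 =
            (Z *m A *m Z^T) i i by [].
  by rewrite mxE [RHS]mxE; apply: eq_bigr => k _; rewrite !mxE.
suff -> : rayleigh P A i = (X *m A *m X^T) i i + (Y *m A *m Y^T) i i.
  by rewrite addr_ge0.
rewrite /rayleigh ePt {1}eP !(mulmxDl, mulmxBr) -!(scalemxAl, scalemxAr).
rewrite -!map_mxM /= !mxE /=; ring.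
Qed.

Lemma spectral_dec_ge0 L P l i : psd L -> spectral_dec L P l -> 0 <= l 0 i.
Proof. by move=> pL /rayleigh_eigen <-; exact: rayleigh_psd. Qed.

(** Let [E] be the spectral projection onto the nonzero eigenvalues. From [L (1 - E) = 0] follows
    [M (1 - E) = 0], and [M E = E] because [E] factors through [L]; so [M = E]. *)
Lemma laplacian_support G P l : spectral_dec (laplacian G) P l ->
  spectral_dec (centering_mx R n) P (support_row l).
Proof.
move=> [uP eL]; split; first exact: uP.
have PtP : P^t* *m P = 1%:M.
  by apply/mulmx1C/unitarymxP.
set E := (X in _ = X).
have LE : toC (laplacian G) *m (1%:M - E) = 0.
  rewrite mulmxBr mulmx1 eL (unitary_diagM _ _ uP).
  apply/eqP; rewrite subr_eq0; apply/eqP.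
  apply: unitary_diag_eq => k; rewrite !mxE.
  by case: eqP => [->|]; rewrite ?mulr0 ?mulr1.
have ME : toC (centering_mx R n) *m (1%:M - E) = 0.
  have [LX LY] := (mul_toC_eq0 _ _).1 LE.
  by apply/mul_toC_eq0; split; apply: laplacian_annihilates; eassumption.
have EM : toC (centering_mx R n) *m E = E.
  pose l' : 'rV[R]_n := \row_k (l 0 k)^-1.
  have -> : E = toC (laplacian G) *m (P^t* *m diag_mx (toC l') *m P).
    rewrite eL (unitary_diagM _ _ uP).
    apply: unitary_diag_eq => k; rewrite !mxE.
    by case: eqVneq => [->|l0]; rewrite -rmorphM ?mul0r ?mulfV.
  by rewrite mulmxA -map_mxM mul_centering_laplacian.
by move: ME; rewrite mulmxBr mulmx1 EM => /eqP; rewrite subr_eq0 => /eqP.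
Qed.

End SpectralDecomposition.

(** * Evaluation of rational functions; singular values *)

Section RationalEvaluation.
Variable R : realType.
Local Notation C := R[i].
Local Notation tofrac := (@FracField.tofrac {poly C}).
Implicit Types (f g : {fraction {poly C}}) (p q : {poly C}) (s v : C).

Lemma fraction_reprE f :
  f * tofrac (fraction.frac (repr f)).2 = tofrac (fraction.frac (repr f)).1.
Proof.
rewrite -{1}[f]reprK; unlock FracField.tofrac; rewrite -[LHS]FracField.pi_mul.
apply/eqmodP; rewrite /= FracField.equivfE /FracField.mulf.
rewrite !numden_Ratio ?oner_neq0 ?mulf_neq0 ?oner_neq0 ?denom_ratioP //.
by rewrite !mulr1 mulrC.
Qed.

(** Any fraction regular at [s] may be used for evaluation: if the reduced denominator vanished at
    [s], cross-multiplication would make the reduced numerator vanish there too, against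
    coprimality. *)
Lemma ratfun_eval_frac p q s :
  q.[s] != 0 -> ratfun_eval (tofrac p / tofrac q) s = p.[s] / q.[s].
Proof.
move=> qs; rewrite /ratfun_eval.
have := fraction_reprE (tofrac p / tofrac q).
have := denom_ratioP (repr (tofrac p / tofrac q)).
set a := (fraction.frac _).1; set b := (fraction.frac _).2 => b0.
have q0 : q != 0 by apply: contraNneq qs => ->; rewrite horner0.
have tq0 : tofrac q != 0 by rewrite tofrac_eq0.
rewrite mulrAC => /(canRL (mulfK _)); rewrite invr_eq0 => /(_ tq0).
rewrite invrK => /eqP; rewrite -!tofracM tofrac_eq => /eqP e.
set d := gcdp a b.
have d0 : d != 0 by rewrite gcdp_eq0 negb_and b0 orbT.
have ea : a %/ d * d = a by rewrite divpK ?dvdp_gcdl.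
have eb : b %/ d * d = b by rewrite divpK ?dvdp_gcdr.
have cop : coprimep (a %/ d) (b %/ d).
  by apply: coprimep_div_gcd; rewrite b0 orbT.
have e' : p * (b %/ d) = (a %/ d) * q.
  by apply: (mulIf d0); rewrite -mulrA eb e mulrAC ea.
have {e'} := congr1 (fun r : {poly C} => r.[s]) e'; rewrite !hornerM => e'.
suff bs : (b %/ d).[s] != 0 by apply/eqP; rewrite eqr_div // -e'.
apply/negP => bs; have : (a %/ d).[s] == 0.
  move: e'; rewrite (eqP bs) mulr0 => /esym/eqP.
  by rewrite mulf_eq0 (negPf qs) orbF.
move=> as0; rewrite coprimep_sym in cop.
by have := coprimep_root cop bs; rewrite as0.
Qed.

(* [ratfun_eval] respects ring operations only away from poles. *)
Definition regular_value f s v : Prop :=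
  exists p q, [/\ q.[s] != 0, f = tofrac p / tofrac q & v = p.[s] / q.[s]].

Lemma regular_value_eval f s v : regular_value f s v -> ratfun_eval f s = v.
Proof. by move=> [p [q [qs -> ->]]]; exact: ratfun_eval_frac. Qed.

Lemma regular_value_poly p s : regular_value (tofrac p) s p.[s].
Proof.
by exists p, 1; rewrite hornerE oner_neq0 tofrac1 !divr1.
Qed.

Lemma regular_valueD f g s v w : regular_value f s v -> regular_value g s w ->
  regular_value (f + g) s (v + w).
Proof.
move=> [p [q [qs -> ->]]] [p' [q' [qs' -> ->]]].
exists (p * q' + p' * q), (q * q').
have t0 r : r.[s] != 0 -> tofrac r != 0.
  by rewrite tofrac_eq0; apply: contraNneq => ->; rewrite horner0.
by rewrite !hornerE mulf_neq0 // tofracD !tofracM !addf_div ?t0.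
Qed.

Lemma regular_valueM f g s v w : regular_value f s v -> regular_value g s w ->
  regular_value (f * g) s (v * w).
Proof.
move=> [p [q [qs -> ->]]] [p' [q' [qs' -> ->]]].
exists (p * p'), (q * q'); rewrite !hornerM; split.
- by rewrite mulf_neq0.
- by rewrite !tofracM mulf_div.
- by rewrite mulf_div.
Qed.

Lemma regular_value_inv p s :
  p.[s] != 0 -> regular_value (tofrac p)^-1 s p.[s]^-1.
Proof.
by move=> ps; exists 1, p; split; rewrite // ?hornerC ?tofrac1 mul1r.
Qed.

Lemma regular_value_sum (I : finType)
    (f : I -> {fraction {poly C}}) (v : I -> C) s :
  (forall i, regular_value (f i) s (v i)) ->
  regular_value (\sum_i f i) s (\sum_i v i).
Proof.
move=> fv; elim/big_ind2: _ => //; last by move=> *; exact: regular_valueD.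
by have := regular_value_poly 0 s; rewrite horner0 tofrac0.
Qed.

End RationalEvaluation.

(** * Singular values of unitarily diagonalized matrices *)

Section SingularValues.
Variables (R : realType) (n : nat).
Local Notation C := R[i].
Implicit Types (P : 'M[C]_n) (g : 'rV[C]_n).

Lemma char_poly_unitary_diag P g : P \is unitarymx ->
  char_poly (P^t* *m diag_mx g *m P) =
  \prod_(x <- [seq g 0 k | k : 'I_n]) ('X - x%:P).
Proof.
move=> uP; have PtP : P^t* *m P = 1%:M by apply/mulmx1C/unitarymxP.
pose tP := map_mx (@polyC C).
have -> : char_poly (P^t* *m diag_mx g *m P) = char_poly (diag_mx g).
  rewrite /char_poly /char_poly_mx.
  have -> : 'X%:M - tP _ _ (P^t* *m diag_mx g *m P) =
            tP _ _ (P^t*) *m ('X%:M - tP _ _ (diag_mx g)) *m tP _ _ P.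
    rewrite /tP mulmxBr mulmxBl -!map_mxM; congr (_ - _).
    by rewrite mul_mx_scalar -scalemxAl -map_mxM PtP map_mx1 scalemx1.
  rewrite !det_mulmx mulrAC -det_mulmx -map_mxM PtP map_mx1 det1 mul1r //.
rewrite char_poly_trig ?diag_mx_is_trig // big_image.
by apply: eq_bigr => k _; rewrite mxE eqxx.
Qed.

(** Two diagonalizations of [D^* D] have the same characteristic polynomial, hence the same roots
    with multiplicity. Their order in [spectral_diag] is not determined, whence the permutation. *)
Lemma singular_value_unitary_diag P g : P \is unitarymx ->
  perm_eq [seq singular_value (P^t* *m diag_mx g *m P) i | i : 'I_n]
          [seq ComplexField.Normc.normc (g 0 k) | k : 'I_n].
Proof.
move=> uP; set D := _ *m P.
have eD : D^t* *m D = P^t* *m diag_mx (\row_k (`|g 0 k| ^+ 2)) *m P.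
  have -> : D^t* = P^t* *m diag_mx (map_mx Num.conj g) *m P.
    by rewrite !trmxC_mul trmxCK tr_diag_mx map_diag_mx mulmxA.
  rewrite (unitary_diagM _ _ uP).
  by apply: unitary_diag_eq => k; rewrite !mxE normCK mulrC.
have nD : D^t* *m D \is normalmx.
  apply/hermitian_normalmx/is_hermitianmxP.
  by rewrite expr0 scale1r [RHS]trmxC_mul trmxCK.
have := orthomx_spectralP nD; set S := spectralmx _; set sp := spectral_diag _.
have uS : S \is unitarymx by exact: spectral_unitarymx.
rewrite invmx_unitary // => eS.
have := congr1 char_poly eD.
rewrite {1}eS !char_poly_unitary_diag // => /prod_XsubC_eq.
move=> /(perm_map (fun z => Num.sqrt (complex.Re z))).
rewrite /image_mem -!map_comp => perm_eigen; apply: etrans perm_eigen.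
congr (perm_eq _ _); apply: eq_map => k /=.
rewrite mxE normc_def -rmorphXn /= sqrtr_sqr ger0_norm ?sqrtr_ge0 //.
by case: (g 0 k).
Qed.

End SingularValues.

(** * The transfer function of a network *)

Section TransferFunctionOfNetwork.
Variables (R : realType) (n : nat) (G : wgraph R n) (x0 : 'cV[R]_n).
Local Notation C := R[i].
Local Notation toC := (map_mx (real_complex R)).
Local Notation tofrac := (@FracField.tofrac {poly C}).
Variables (P : 'M[C]_n) (l : 'rV[R]_n).
Hypothesis decG : spectral_dec (laplacian G) P l.

Let cstF : {rmorphism C -> {fraction {poly C}}} := tofrac \o polyC.

Lemma cst_ratmxE (A : 'M[R]_n) : cst_ratmx A = map_mx cstF (toC A).
Proof. by apply/matrixP => i j; rewrite !mxE. Qed.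

Lemma transfer_function_network :
  transfer_function (network x0 (laplacian G)) =
  map_mx cstF (P^t*) *m
  diag_mx (\row_k (cstF (support_row l 0 k)%:C%C /
                   tofrac ('X + (l 0 k)%:C%C%:P))) *m
  map_mx cstF P.
Proof.
have [uP eL] := decG; have [_ eM] := laplacian_support decG.
have UV : map_mx cstF P *m map_mx cstF (P^t*) = 1%:M.
  by rewrite -map_mxM (unitarymxP uP) map_mx1.
have VU := mulmx1C UV.
(* Nonzero as a polynomial even if [l 0 k = 0], so the resolvent exists over the fraction field; the
   pole at 0 is cancelled later by the support factor. *)
have Xl0 k : tofrac ('X + (l 0 k)%:C%C%:P) != 0.
  rewrite tofrac_eq0 -size_poly_gt0 -[_%:P]opprK -polyCN.
  by rewrite size_XsubC.
pose D := diag_mx (\row_k tofrac ('X + (l 0 k)%:C%C%:P)).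
pose D' := diag_mx (\row_k (tofrac ('X + (l 0 k)%:C%C%:P))^-1).
have DD' : D *m D' = 1%:M.
  rewrite mulmx_diag; apply/matrixP => i j; rewrite !mxE.
  by rewrite mulfV.
have conjM (X Y : 'M[{fraction {poly C}}]_n) :
    (map_mx cstF (P^t*) *m X *m map_mx cstF P) *m
    (map_mx cstF (P^t*) *m Y *m map_mx cstF P) =
    map_mx cstF (P^t*) *m (X *m Y) *m map_mx cstF P.
  by rewrite !mulmxA -(mulmxA _ (map_mx cstF P) (map_mx cstF (P^t*))) UV mulmx1.
have eA : (tofrac 'X)%:M - cst_ratmx (- laplacian G) =
          map_mx cstF (P^t*) *m D *m map_mx cstF P.
  have -> : D = (tofrac 'X)%:M + map_mx cstF (diag_mx (toC l)).
    apply/matrixP => i j; rewrite !mxE tofracD.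
    by case: eqP => _; rewrite ?mulr1n ?mulr0n ?rmorph0 ?addr0.
  rewrite cst_ratmxE !map_mxN opprK eL !map_mxM mulmxDr mulmxDl.
  by rewrite mul_mx_scalar -scalemxAl VU scalemx1.
have eAV : invmx ((tofrac 'X)%:M - cst_ratmx (- laplacian G)) =
          map_mx cstF (P^t*) *m D' *m map_mx cstF P.
  rewrite eA; set B := _ *m D *m _; set B' := _ *m D' *m _.
  have BB' : B *m B' = 1%:M by rewrite conjM DD' mulmx1.
  by have [uB _] := mulmx1_unit BB'; rewrite -[RHS](mulKmx uB) BB' mulmx1.
rewrite /transfer_function /= eAV !cst_ratmxE eM map_mx1 map_mx1 mulmx1.
rewrite 2!map_mxM conjM; congr (_ *m _ *m _).
rewrite map_diag_mx mulmx_diag; congr diag_mx.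
by apply/rowP => k; rewrite !mxE.
Qed.

Lemma ratmx_eval_network (w : R) :
  ratmx_eval (transfer_function (network x0 (laplacian G))) (0 +i* w)%C =
  P^t* *m
  diag_mx (\row_k ((support_row l 0 k)%:C%C / (0 +i* w + (l 0 k)%:C)%C)) *m P.
Proof.
apply/matrixP => i j; rewrite transfer_function_network.
rewrite mxE; apply: regular_value_eval.
rewrite mxE [X in regular_value _ _ X]mxE.
apply: regular_value_sum => k; rewrite !mul_mx_diag !mxE.
have evC z : regular_value (cstF z) (0 +i* w)%C z.
  by have := regular_value_poly z%:P (0 +i* w)%C; rewrite hornerC.
apply: regular_valueM; last exact: evC.
apply: regular_valueM; first exact: evC.
(* For a zero eigenvalue the entry is the zero function, which is regular at [w = 0] although its
   written denominator vanishes there. *)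
case: eqVneq => [_|lk].
  rewrite /= mulr0n !rmorph0 !mul0r; by have := evC 0; rewrite rmorph0.
apply: regular_valueM; first exact: evC.
have := @regular_value_inv _ ('X + (l 0 k)%:C%C%:P) (0 +i* w)%C.
rewrite !hornerE; apply.
by rewrite eq_complex /= add0r (negPf lk).
Qed.

Lemma singular_value_network (w : R) :
  perm_eq
    [seq singular_value (ratmx_eval
       (transfer_function (network x0 (laplacian G))) (0 +i* w)%C) i | i : 'I_n]
    [seq support_row l 0 k / Num.sqrt (w ^+ 2 + l 0 k ^+ 2) | k : 'I_n].
Proof.
have [uP _] := decG.
rewrite ratmx_eval_network; apply: etrans (singular_value_unitary_diag _ uP).
congr (perm_eq _ _); apply: eq_map => k; rewrite [in RHS]mxE.
rewrite ComplexField.Normc.normcM ComplexField.Normc.normcV.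
congr (_ / _); rewrite /= ?expr0n /= ?addr0 ?add0r; last by rewrite addrC.
by rewrite mxE sqrtr_sqr ger0_norm ?ler0n.
Qed.

End TransferFunctionOfNetwork.

(** * Closed form of the norms *)

Section NetworkNorm.
Variables (R : realType) (n : nat) (G : wgraph R n) (x0 : 'cV[R]_n).
Local Notation mu := (@lebesgue_measure R).
Variables (P : 'M[R[i]]_n) (l : 'rV[R]_n).
Hypothesis decG : spectral_dec (laplacian G) P l.

Let l_ge0 k : 0 <= l 0 k.
Proof. exact: spectral_dec_ge0 (psd_laplacian G) decG. Qed.

Let l_gt0 k : l 0 k != 0 -> 0 < l 0 k.
Proof. by rewrite lt_def l_ge0 andbT. Qed.

(** Commutativity absorbs the unknown order of the singular values; a general [op] covers both the
    sum and the maximum. *)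
Lemma big_singular_value_network (op : SemiGroup.com_law R) idx f w :
  \big[op/idx]_i f (singular_value (ratmx_eval
    (transfer_function (network x0 (laplacian G))) (0 +i* w)%C) i) =
  \big[op/idx]_k f (support_row l 0 k * lorentz (l 0 k) w).
Proof.
have := perm_big _ (singular_value_network x0 decG w).
by move=> /(_ _ op idx predT f); rewrite !big_image.
Qed.

Lemma Hp_norm_network p : 0 < p ->
  network_Hp_norm p%:E (network x0 (laplacian G)) =
  ((((2 * pi)^-1)%:E * (lorentz_integral p *
    (\sum_(k | l 0 k != 0) l 0 k `^ (1 - p))%:E)) `^ p^-1)%E.
Proof.
move=> p0; rewrite /network_Hp_norm /Hp_norm; congr ((_ * _) `^ _)%E.
(* The dummy value 1 makes every integrand measurable, including those at indices filtered out of
   the sum. *)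
pose r k := if l 0 k == 0 then 1 else l 0 k.
have r_gt0 k : 0 < r k by rewrite /r; case: eqVneq => // /l_gt0.
transitivity (\int[mu]_w \sum_(k <- [seq k <- index_enum 'I_n | l 0%R k != 0%R])
                (lorentz (r k) w `^ p)%:E)%E.
  apply: eq_integral => w _; rewrite -powRrM mulVf ?gt_eqF // powRr1; last first.
    by apply: sumr_ge0 => k _; exact: powR_ge0.
  rewrite sumEFin; congr (_%:E).
  rewrite (big_singular_value_network _ _ (fun x => x `^ p)).
  rewrite big_filter [RHS]big_mkcond; apply: eq_bigr => k _.
  rewrite mxE /r; case: eqVneq => /= _; last by rewrite mul1r.
  by rewrite mul0r powR0 ?gt_eqF.
rewrite ge0_integral_sum //; last 2 first.
- by move=> k; exact: measurable_lorentz_powR.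
- by move=> k w _; rewrite lee_fin; exact: powR_ge0.
rewrite big_filter -sumEFin ge0_sume_distrr; last first.
  by move=> k _; rewrite lee_fin powR_ge0.
apply: eq_bigr => k lk.
by rewrite lorentz_integral_scale // /r (negPf lk) muleC.
Qed.

Lemma Hp_norm_network_gt1 p : 1 < p ->
  network_Hp_norm p%:E (network x0 (laplacian G)) =
  (((2 * pi)^-1 * fine (lorentz_integral p)) `^ p^-1 *
   (\sum_(k | l 0 k != 0) l 0 k `^ (1 - p)) `^ p^-1)%:E.
Proof.
move=> p1; have /fineK Kp := lorentz_integral_fin p1.
rewrite Hp_norm_network ?(lt_trans _ p1) // -{1}Kp.
rewrite -powRM ?mulr_ge0 ?invr_ge0 ?mulr_ge0 ?pi_ge0 ?fine_ge0
  ?lorentz_integral_ge0 //.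
  by rewrite -mulrA.
by apply: sumr_ge0 => k _; exact: powR_ge0.
Qed.

(* Zero eigenvalues are harmless here, since [0^-1 = 0]. *)
Lemma Hinf_norm_network :
  network_Hp_norm +oo%E (network x0 (laplacian G)) =
  (\big[Num.max/0]_k (l 0 k)^-1)%:E.
Proof.
rewrite /network_Hp_norm /Hp_norm /schatten_norm.
have norm_w w : \big[Num.max/0]_i singular_value (ratmx_eval
    (transfer_function (network x0 (laplacian G))) (0 +i* w)%C) i =
    \big[Num.max/0]_k (support_row l 0 k * lorentz (l 0 k) w).
  exact: (big_singular_value_network _ _ id).
(* The supremum over frequencies is attained at [w = 0]. *)
have norm_0 : \big[Num.max/0]_k (support_row l 0 k * lorentz (l 0 k) 0) =
              \big[Num.max/0]_k (l 0 k)^-1.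
  apply: eq_bigr => k _.
  rewrite mxE /lorentz expr0n add0r sqrtr_sqr ger0_norm //.
  by case: eqVneq => [->|_]; rewrite ?mul0r ?invr0 ?mul1r.
apply/eqP; rewrite eq_le; apply/andP; split.
  apply: ge_ereal_sup => _ [w _ <-]; rewrite norm_w lee_fin.
  rewrite -norm_0; apply: le_bigmax2 => k _; rewrite mxE.
  case: eqVneq => [->|lk]; rewrite ?mul0r // !mul1r.
  rewrite lef_pV2 ?posrE ?sqrtr_gt0 ?sqr_lorentz_gt0 ?l_gt0 //.
  by rewrite ler_wsqrtr // expr0n add0r lerDr sqr_ge0.
apply: ereal_sup_ubound; exists 0 => //=.
by rewrite norm_w norm_0.
Qed.

End NetworkNorm.

(** * Comparison of norms *)

Section Comparison.
Variables (R : realType) (n : nat).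
Local Notation C := R[i].
Local Notation toC := (map_mx (real_complex R)).
Implicit Types (S A B : wgraph R n) (P Q : 'M[C]_n) (s l : 'rV[R]_n).
Local Notation normc := ComplexField.Normc.normc.

(** The centering matrix is the support projection of both Laplacians; its diagonal entry at [i] is
    computed in either eigenbasis. *)
Lemma support_weights S A P Q s l :
  spectral_dec (laplacian S) P s -> spectral_dec (laplacian A) Q l ->
  forall i, s 0 i != 0 ->
  \sum_(j | l 0 j != 0) normc ((P *m Q^t*) i j) ^+ 2 = 1.
Proof.
move=> decS decA i si.
transitivity (rayleigh P (centering_mx R n) i); last first.
  by rewrite (rayleigh_eigen i (laplacian_support decS)) mxE si.
rewrite (rayleigh_dec P i (laplacian_support decA)) big_mkcond.
apply: eq_bigr => j _; rewrite [support_row l 0 j]mxE.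
by case: ifP; rewrite ?mulr1 ?mulr0.
Qed.

Lemma rayleigh_laplacian A P Q l i : spectral_dec (laplacian A) Q l ->
  rayleigh P (laplacian A) i =
  \sum_(j | l 0 j != 0) normc ((P *m Q^t*) i j) ^+ 2 * l 0 j.
Proof.
move=> decA; rewrite (rayleigh_dec _ _ decA) [RHS]big_mkcond.
by apply: eq_bigr => j _; case: eqVneq => // ->; rewrite mulr0.
Qed.

(** Turns column sums of the weights into row sums with the two graphs exchanged. *)
Lemma normc_mul_trmxC P Q i j :
  normc ((Q *m P^t*) j i) = normc ((P *m Q^t*) i j).
Proof.
have normc_conj (z : C) : normc z^* = normc z.
  by case: z => x y /=; rewrite sqrrN.
have -> : Q *m P^t* = (P *m Q^t*)^t* by rewrite trmxC_mul trmxCK.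
by rewrite [in LHS]mxE [in LHS]mxE normc_conj.
Qed.

Section FixedDecompositions.
Variables (S A : wgraph R n) (P Q : 'M[C]_n) (s l : 'rV[R]_n).
Hypotheses (decS : spectral_dec (laplacian S) P s)
           (decA : spectral_dec (laplacian A) Q l).
Local Notation a := (rayleigh P (laplacian A)).

Let l_gt0 j : l 0 j != 0 -> 0 < l 0 j.
Proof. by rewrite lt_def (spectral_dec_ge0 _ (psd_laplacian A) decA) andbT. Qed.

Lemma rayleigh_jensen r i : 0 <= r -> s 0 i != 0 ->
  0 < a i /\
  a i `^ (- r) <=
  \sum_(j | l 0 j != 0) normc ((P *m Q^t*) i j) ^+ 2 * l 0 j `^ (- r).
Proof.
move=> r0 si; rewrite (rayleigh_laplacian _ _ decA).
apply: powRN_jensen => // [j|]; first exact: sqr_ge0.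
exact: support_weights decS decA _ si.
Qed.

(** Jensen uses that the weights sum to 1 over [j]; after exchanging the sums, that they also sum to
    1 over [i]. *)
Lemma sum_rayleigh_powRN r : 0 <= r ->
  \sum_(i | s 0 i != 0) a i `^ (- r) <= \sum_(j | l 0 j != 0) l 0 j `^ (- r).
Proof.
move=> r0; apply: le_trans (_ : _ <= \sum_(i | s 0 i != 0)
    \sum_(j | l 0 j != 0) normc ((P *m Q^t*) i j) ^+ 2 * l 0 j `^ (- r)) _.
  by apply: ler_sum => i si; have [] := rayleigh_jensen r0 si.
rewrite exchange_big; apply: ler_sum => j lj /=.
rewrite -mulr_suml.
under eq_bigr => i _ do rewrite -normc_mul_trmxC.
by rewrite (support_weights decA decS lj) mul1r.
Qed.

Lemma inv_rayleigh_le i : s 0 i != 0 ->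
  0 < a i /\ (a i)^-1 <= \big[Num.max/0]_j (l 0 j)^-1.
Proof.
move=> si; have [a0 le_a] := rayleigh_jensen (@ler01 R) si; split=> //.
rewrite -powR_inv1 ?(ltW a0) //; apply: (le_trans le_a).
set N := \big[_/_]_j _.
have -> : N = \sum_(j | l 0 j != 0) normc ((P *m Q^t*) i j) ^+ 2 * N.
  by rewrite -mulr_suml (support_weights decS decA si) mul1r.
apply: ler_sum => j lj; apply: ler_wpM2l; first exact: sqr_ge0.
rewrite powR_inv1 ?(ltW (l_gt0 lj)) //.
exact: le_bigmax.
Qed.

End FixedDecompositions.

(** The multiplicity count depends on [n] alone, which settles the case [p = 1]. *)
Lemma card_support A P l : spectral_dec (laplacian A) P l ->
  \sum_(k | l 0 k != 0) (1 : R) = \tr (centering_mx R n).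
Proof.
move=> decA; have [uP eM] := laplacian_support decA.
apply: (@complexI R); rewrite -trace_map_mx eM mxtrace_mulC mulmxA.
rewrite (unitarymxP uP) mul1mx mxtrace_diag rmorph_sum big_mkcond.
by apply: eq_bigr => k _; rewrite !mxE; case: eqP.
Qed.

Lemma network_Hp_norm_le (p : \bar R) (x0 : 'cV[R]_n) S A B (c : R) :
  (1 <= p)%E -> 0 <= c <= 1 ->
  loewner_le (c *: laplacian A + (1 - c) *: laplacian B) (laplacian S) ->
  (network_Hp_norm p (network x0 (laplacian S)) <=
   c%:E * network_Hp_norm p (network x0 (laplacian A)) +
   (1 - c)%:E * network_Hp_norm p (network x0 (laplacian B)))%E.
Proof.
move=> p1 c01 leABS; have /andP[c0 c1] := c01.
have c1' : 0 <= 1 - c by rewrite subr_ge0.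
have [P [s decS]] := spectral_dec_exists (laplacian_sym S).
have [PA [lA decA]] := spectral_dec_exists (laplacian_sym A).
have [PB [lB decB]] := spectral_dec_exists (laplacian_sym B).
pose a := rayleigh P (laplacian A); pose b := rayleigh P (laplacian B).
(* The Loewner hypothesis, read on the diagonal in the eigenbasis of the Laplacian of [S]. *)
have s_ge i : c * a i + (1 - c) * b i <= s 0 i.
  rewrite -(rayleigh_eigen i decS) -!rayleighZ -rayleighD -subr_ge0.
  rewrite -mulN1r -rayleighZ -rayleighD scaleN1r.
  exact: rayleigh_psd.
have s_ge0 i : 0 <= s 0 i by exact: spectral_dec_ge0 (psd_laplacian S) decS.
case: p p1 => [p|_|//]; last first.
  rewrite (Hinf_norm_network _ decS) (Hinf_norm_network _ decA)
    (Hinf_norm_network _ decB) -!EFinM -EFinD lee_fin.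
  set NA := \big[_/_]_k (lA 0 k)^-1; set NB := \big[_/_]_k (lB 0 k)^-1.
  have NA0 : 0 <= NA by exact: bigmax_ge_id.
  have NB0 : 0 <= NB by exact: bigmax_ge_id.
  have N0 : 0 <= c * NA + (1 - c) * NB by rewrite addr_ge0 ?mulr_ge0.
  apply: bigmax_le => // i _.
  have [s0|si] := eqVneq (s 0 i) 0; first by rewrite s0 invr0.
  have [a0 aN] := inv_rayleigh_le decS decA si.
  have [b0 bN] := inv_rayleigh_le decS decB si.
  have [m0 mN] := powRN_convex c01 (@ler01 R) a0 b0.
  rewrite !powR_inv1 ?(ltW m0) ?(ltW a0) ?(ltW b0) // in mN.
  apply: (@le_trans _ _ (c * a i + (1 - c) * b i)^-1).
    by rewrite lef_pV2 ?posrE // lt_def si s_ge0.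
  by apply: (le_trans mN); apply: lerD; rewrite ler_wpM2l.
rewrite lee_fin le_eqVlt => /predU1P[<-|p1].
  rewrite (Hp_norm_network _ decS ltr01) (Hp_norm_network _ decA ltr01).
  rewrite (Hp_norm_network _ decB ltr01) subrr.
  have sum1 A' P' l' : spectral_dec (laplacian A') P' l' ->
      \sum_(k | l' 0 k != 0) l' 0 k `^ 0 = \tr (centering_mx R n).
    by move=> /card_support <-; apply: eq_bigr => k _; rewrite powRr0.
  rewrite (sum1 _ _ _ decS) (sum1 _ _ _ decA) (sum1 _ _ _ decB).
  rewrite -ge0_muleDl ?lee_fin // -EFinD addrC subrK mul1e //.
have p0 : 0 < p by exact: lt_trans p1.
rewrite (Hp_norm_network_gt1 _ decS p1) (Hp_norm_network_gt1 _ decA p1).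
rewrite (Hp_norm_network_gt1 _ decB p1) -!EFinM -EFinD lee_fin.
rewrite !(mulrCA _ (_ `^ _)) -mulrDr ler_wpM2l ?powR_ge0 //.
(* If all eigenvalues vanish, the norm of [S] is 0. Otherwise [i] makes the sums nonempty, so that
   the bounds for [A] and [B] are strictly positive. *)
have [i si|noi] := pickP (fun i => s 0 i != 0); last first.
  rewrite big_pred0 // powR0 ?invr_eq0 ?gt_eqF //.
  by rewrite addr_ge0 ?mulr_ge0 ?powR_ge0.
pose q := p - 1; have q0 : 0 < q by rewrite subr_gt0.
have -> : 1 - p = - q by rewrite opprB.
have -> : p^-1 = (1 + q)^-1 by rewrite /q addrC subrK.
have a0 j : s 0 j != 0 -> 0 < a j.
  by move=> /(rayleigh_jensen decS decA (ltW q0))[].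
have b0 j : s 0 j != 0 -> 0 < b j.
  by move=> /(rayleigh_jensen decS decB (ltW q0))[].
have sA := sum_rayleigh_powRN decS decA (ltW q0).
have sB := sum_rayleigh_powRN decS decB (ltW q0).
have gt0 f (T : R) : (forall j, s 0 j != 0 -> 0 < f j) ->
    \sum_(j | s 0 j != 0) f j `^ (- q) <= T -> 0 < T.
  move=> f0; apply: lt_le_trans.
  rewrite (bigD1 i) //= ltr_pwDl ?powR_gt0 ?f0 //.
  by apply: sumr_ge0 => j _; exact: powR_ge0.
apply: le_trans (power_mean_convex c01 q0 a0 b0
  (gt0 _ _ a0 sA) (gt0 _ _ b0 sB) sA sB).
apply: ge0_ler_powR; rewrite ?nnegrE.
- by rewrite invr_ge0 addr_ge0 ?(ltW q0).
- by apply: sumr_ge0 => j _; exact: powR_ge0.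
- by apply: sumr_ge0 => j _; exact: powR_ge0.
apply: ler_sum => j sj.
have [m0 _] := powRN_convex c01 (ltW q0) (a0 _ sj) (b0 _ sj).
rewrite !powRN lef_pV2 ?posrE ?powR_gt0 //; last by rewrite lt_def sj s_ge0.
by apply: ge0_ler_powR; rewrite ?nnegrE ?(ltW q0) ?(ltW m0).
Qed.

Lemma spectral_dec_orthogonal A P l (U : 'M[R]_n) : orthogonal_mx U ->
  spectral_dec (laplacian A) P l ->
  spectral_dec (U *m laplacian A *m U^T) (P *m (toC U)^t*) l.
Proof.
move=> [UUt UtU] [uP eA]; split.
  apply: mul_unitarymx; first exact: uP.
  apply/unitarymxP; rewrite trmxCK map_real_conj.
  by rewrite -map_mxM UtU map_mx1.
rewrite trmxC_mul trmxCK !map_mxM eA map_real_conj.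
by rewrite !mulmxA.
Qed.

(** The closed forms involve the graph only through [l]. *)
Lemma network_Hp_norm_spectrum (p : \bar R) (x0 : 'cV[R]_n) A B P Q l :
  (1 <= p)%E ->
  spectral_dec (laplacian A) P l -> spectral_dec (laplacian B) Q l ->
  network_Hp_norm p (network x0 (laplacian A)) =
  network_Hp_norm p (network x0 (laplacian B)).
Proof.
case: p => [p p1|_|/notF[]] decA decB; last first.
  rewrite (Hinf_norm_network _ decA) (Hinf_norm_network _ decB).
  reflexivity.
have p0 : 0 < p by move: p1; rewrite lee_fin; exact: lt_le_trans.
rewrite (Hp_norm_network _ decA p0) (Hp_norm_network _ decB p0); reflexivity.
Qed.

Lemma network_Hp_norm_fin_num (p : \bar R) (x0 : 'cV[R]_n) A : (1 < p)%E ->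
  network_Hp_norm p (network x0 (laplacian A)) \is a fin_num.
Proof.
have [P [l decA]] := spectral_dec_exists (laplacian_sym A).
case: p => [p|_|/notF[]]; last by rewrite (Hinf_norm_network _ decA).
by rewrite lte_fin => p1; rewrite (Hp_norm_network_gt1 _ decA p1).
Qed.

Lemma networksP (x0 : 'cV[R]_n) (L : 'M[R]_n) :
  networks x0 (network x0 L) -> exists G, L = laplacian G.
Proof. by move=> [G _ [/oppr_inj <-]]; exists G. Qed.

End Comparison.

Theorem theorem2 (R : realType) (n : nat) (x0 : 'cV[R]_n) (p : \bar R)
    (n_gt0 : (0 < n)%N) (p_ge1 : (1 <= p)%E) :
  schur_convex_systemic_measure x0 (@network_Hp_norm R p n) /\
  ((1 < p)%E -> real_valued x0 (@network_Hp_norm R p n)).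
Proof.
split; last by move=> p1 _ [G _ <-]; exact: network_Hp_norm_fin_num.
split.
- move=> _ _ /networksP[G1 ->] /networksP[G2 ->] /loewner_le_pinv le21.
  have eE (x : \bar R) : (0%:E * x + (1 - 0)%:E * x)%E = x.
    by rewrite mul0e add0e subr0 mul1e.
  have eM (L : 'M[R]_n) : 0 *: L + (1 - 0) *: L = L.
    by rewrite scale0r add0r subr0 scale1r.
  rewrite -[leRHS]eE; apply: (network_Hp_norm_le x0 p_ge1).
    by rewrite lexx ler01.
  by rewrite eM.
- move=> L1 L2 net1 net2 a a01.
  (* The combination is itself the Laplacian of some [G], so the comparison applies with zero
     difference. *)
  have [G eG] := networksP (networks_convex net1 net2 a01).
  have [G1 e1] := networksP net1; have [G2 e2] := networksP net2.
  rewrite eG e1 e2; apply: (network_Hp_norm_le x0 p_ge1 a01).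
  rewrite -e1 -e2 eG /loewner_le subrr; split=> [|v]; first by rewrite trmx0.
  by rewrite mulmx0 mul0mx mxE.
- move=> _ U /networksP[G ->] oU /networksP[G' eG'].
  have [P [l decG]] := spectral_dec_exists (laplacian_sym G).
  have decG' := spectral_dec_orthogonal oU decG.
  rewrite eG' in decG' *.
  exact: (network_Hp_norm_spectrum x0 p_ge1 decG decG').
Qed.
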